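(* For every $n\ge1$ let $(\xi_i,\mathcal{F}_i)_{i=0,\dots,n}$ be a sequence of martingale differences (allowed to depend on $n$), let $X_n=\sum_{i=1}^n\xi_i$, and assume that conditions (A1) and (A2) hold with parameters $\epsilon=\epsilon_n\in(0,\frac12]$ and $\delta=\delta_n\in[0,\frac12]$ satisfying $\epsilon_n\to0$ and $\delta_n\to0$ as $n\to\infty$. Let $(a_n)$ be any sequence of real numbers with $a_n\to\infty$ and $a_n\epsilon_n\to0$ as $n\to\infty$. Then for each Borel set $B\subseteq\mathbb{R}$, $$-\inf_{x\in B^o}\frac{x^2}{2}\le\liminf_{n\to\infty}\frac{1}{a_n^2}\log\mathbb{P}\Big(\frac{1}{a_n}X_n\in B\Big)\le\limsup_{n\to\infty}\frac{1}{a_n^2}\log\mathbb{P}\Big(\frac{1}{a_n}X_n\in B\Big)\le-\inf_{x\in\overline{B}}\frac{x^2}{2},$$ where $B^o$ and $\overline{B}$ denote the interior and the closure of $B$ respectively.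
   Context: For each $n$, $(\xi_i,\mathcal{F}_i)_{i=0,\dots,n}$ is a sequence of square integrable real martingale differences on a probability space $(\Omega,\mathcal{F},\mathbb{P})$: $\xi_0=0$, $\{\emptyset,\Omega\}=\mathcal{F}_0\subseteq\dots\subseteq\mathcal{F}_n\subseteq\mathcal{F}$ are increasing $\sigma$-fields, each $\xi_i$ is $\mathcal{F}_i$-measurable and $\mathbb{E}(\xi_i|\mathcal{F}_{i-1})=0$ for $1\le i\le n$. The quadratic characteristic is $\langle X\rangle_n=\sum_{i=1}^n\mathbb{E}(\xi_i^2|\mathcal{F}_{i-1})$. (In)equalities between random variables hold $\mathbb{P}$-almost surely. Conventions: $\inf\emptyset=+\infty$ and $\log0=-\infty$. Condition (A1), with parameter $\epsilon\in(0,\frac12]$: the moments exist and $|\mathbb{E}(\xi_i^k|\mathcal{F}_{i-1})|\le \frac12 k!\,\epsilon^{k-2}\,\mathbb{E}(\xi_i^2|\mathcal{F}_{i-1})$ for all $k\ge3$ and $1\le i\le n$. Condition (A2), with parameter $\delta\in[0,\frac12]$: $|\langle X\rangle_n-1|\le\delta^2$. *)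

(* Defs.v *)
From HB Require Import structures.
From mathcomp Require Import all_boot all_order all_algebra.
From mathcomp Require Import all_classical all_reals all_analysis.

Set Implicit Arguments.
Unset Strict Implicit.
Unset Printing Implicit Defensive.

Import Order.TTheory GRing.Theory Num.Theory.
Import numFieldNormedType.Exports.

Local Open Scope classical_set_scope.
Local Open Scope ring_scope.

(** Sub-sigma-fields are represented by the set of their events. *)

Definition measurable_wrt (T : Type) (R : realType)
    (G : set (set T)) (X : T -> R) : Prop :=
  forall B : set R, measurable B -> G (X @^-1` B).

Definition is_condexp (R : realType) (d : measure_display)
    (T : measurableType d) (P : probability T R)
    (G : set (set T)) (X Y : T -> R) : Prop :=
  [/\ measurable_wrt G Y,
      P.-integrable setT (EFin \o Y) &
      forall A : set T, G A ->
        (\int[P]_(w in A) (Y w)%:E = \int[P]_(w in A) (X w)%:E)%E].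

(** A version of E(X | G), chosen arbitrarily. It is meaningful when [G] is a
    sub-sigma-field and [X] is integrable: a version then exists and any two
    agree almost surely. Otherwise, if there is no version, the value is the
    dummy [fun=> 0]. *)
Definition condexp (R : realType) (d : measure_display)
    (T : measurableType d) (P : probability T R)
    (G : set (set T)) (X : T -> R) : T -> R :=
  xget (fun=> 0) [set Y | is_condexp P G X Y].

(** Square integrable martingale differences (xi_i, F_i) for i = 0, ..., n; the
    values of [F] and [xi] at indices i > n are irrelevant. *)
Record martingale_differences (R : realType) (d : measure_display)
    (T : measurableType d) (P : probability T R) (n : nat)
    (F : nat -> set (set T)) (xi : nat -> T -> R) : Prop := {
  md_F0 : F 0%N = [set set0; setT] ;
  md_sigma : forall i, (i <= n)%N -> sigma_algebra setT (F i) ;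
  md_incr : forall i, (i < n)%N -> F i `<=` F i.+1 ;
  md_sub : forall i, (i <= n)%N -> F i `<=` measurable ;
  md_adapted : forall i, (i <= n)%N -> measurable_wrt (F i) (xi i) ;
  md_sqint : forall i, (i <= n)%N ->
    P.-integrable setT (fun w => (xi i w ^+ 2)%:E) ;
  md_xi0 : {ae P, forall w, xi 0%N w = 0} ;
  md_center : forall i, (1 <= i <= n)%N ->
    {ae P, forall w, condexp P (F i.-1) (xi i) w = 0} }.

Definition quadratic_char (R : realType) (d : measure_display)
    (T : measurableType d) (P : probability T R) (n : nat)
    (F : nat -> set (set T)) (xi : nat -> T -> R) : T -> R :=
  fun w => \sum_(1 <= i < n.+1)
    condexp P (F i.-1) (fun w' => xi i w' ^+ 2) w.

Definition conditional_bernstein (R : realType) (d : measure_display)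
    (T : measurableType d) (P : probability T R) (n : nat)
    (F : nat -> set (set T)) (xi : nat -> T -> R) (eps : R) : Prop :=
  forall k i : nat, (3 <= k)%N -> (1 <= i <= n)%N ->
    P.-integrable setT (fun w => (xi i w ^+ k)%:E) /\
    {ae P, forall w,
      `|condexp P (F i.-1) (fun w' => xi i w' ^+ k) w| <=
        2^-1 * (k`!)%:R * eps ^+ (k - 2) *
        condexp P (F i.-1) (fun w' => xi i w' ^+ 2) w}.

Definition quadratic_char_near1 (R : realType) (d : measure_display)
    (T : measurableType d) (P : probability T R) (n : nat)
    (F : nat -> set (set T)) (xi : nat -> T -> R) (delta : R) : Prop :=
  {ae P, forall w, `|quadratic_char P n F xi w - 1| <= delta ^+ 2}.

Definition martingale_sum (T : Type) (R : realType) (n : nat)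
    (xi : nat -> T -> R) : T -> R :=
  fun w => \sum_(1 <= i < n.+1) xi i w.

(** inf_{x in A} x^2/2, with value +oo when [A] is empty. *)
Definition gauss_rate_inf (R : realType) (A : set R) : \bar R :=
  ereal_inf [set (x ^+ 2 / 2)%:E | x in A].

(** a^-2 log P (X / a \in B); [lne 0 = -oo]. *)
Definition scaled_log_prob (R : realType) (d : measure_display)
    (T : measurableType d) (P : probability T R)
    (X : T -> R) (a : R) (B : set R) : \bar R :=
  ((a ^+ 2)^-1%:E * lne (P [set w | B (a^-1 * X w)%R]))%E.

(* Main.v *)
Require Import Defs.
From HB Require Import structures.
From mathcomp Require Import all_boot all_order all_algebra.
From mathcomp Require Import all_classical all_reals all_analysis.
From mathcomp Require Import measurable_realfun ring lra.

Set Implicit Arguments.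
Unset Strict Implicit.
Unset Printing Implicit Defensive.

Import Order.TTheory GRing.Theory Num.Theory.
Import numFieldNormedType.Exports HBNNSimple.

Local Open Scope classical_set_scope.
Local Open Scope ring_scope.

(** The proof goes through the scaled cumulant generating function: for every
    real t, a_n^-2 log E exp(t a_n X_n) tends to t^2/2 ([mgf_le], [mgf_ge],
    [near_scaled_cgf_exponents]), and this limit alone implies the large
    deviation bounds with speed a_n^2 and rate x^2/2 ([ldp_of_scaled_cgf]).

    Generating function. Write v_i = E(xi_i^2 | F_(i-1)) and let th be
    |t| eps / (1 - |t| eps). Expanding exp(t xi_i) and bounding the terms of
    order at least 3 by the Bernstein condition gives, for |t| eps < 1,
      1 + t^2/2 (1 - th) v_i <= E(exp(t xi_i) | F_(i-1))
                             <= 1 + t^2/2 (1 + th) v_i.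
    The right side is at most exp(c v_i) with c = t^2/2 (1 + th). For the left
    side one needs v_i to be small: the condition at k = 4 forces
    v_i <= 12 eps^2, hence 1 + y >= exp(y (1 - s)) for y = t^2/2 (1 - th) v_i and
    s = 6 t^2 eps^2. So exp(t X_i - c <X>_i) is a supermartingale, and a
    submartingale for c = t^2/2 (1 - th) (1 - s). As <X>_n is within delta^2
    of 1, both sides of E exp(t X_n) are controlled. With t replaced by t a_n,
    the errors th, s and delta^2 vanish because a_n eps_n and delta_n do.

    The conditional inequalities for exp(t xi_i) are expressed as inequalities
    between integrals over the events of F_(i-1), and [le_integral_weight]
    extends them to integrals against nonnegative F_(i-1)-measurable weights,
    which is all the induction over i uses. As [condexp] is a choice among
    versions, their existence is first derived from the Radon-Nikodym theorem.

    Large deviations. If r <= |x| on B then the Chernoff bound at the two points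
    r and -r gives P(X_n / a_n in B) <= exp(- a_n^2 (r^2/2 - o(1))). For the
    lower bound near an interior point x of B, the weight exp(x a_n X_n) plays
    the role of a change of measure: its mass is exp(a_n^2 (x^2/2 + o(1))), while
    its mass off the ball of radius r about x is at most
    2 exp(a_n^2 (x^2/2 - r^2/2 + o(1))), by two more Chernoff bounds at x + r
    and x - r; what remains sits on the ball, where the weight is at most
    exp(a_n^2 (x^2 + |x| r)). *)

(** * Versions of conditional expectations *)

Lemma measurable_wrtP (d : measure_display) (T : measurableType d)
    (R : realType) (G : set (set T)) (X : T -> R) :
  sigma_algebra setT G ->
  measurable_wrt G X <->
  measurable_fun setT (X : g_sigma_algebraType G -> R).
Proof.
move=> sG; have mG := measurable_g_measurableTypeE sG; split=> [mX|mX B mB].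
  by move=> _ B mB; rewrite setTI mG; exact: mX.
by rewrite -[X in X _]mG -[X in measurable X]setTI; exact: mX.
Qed.

Lemma measurable_idfun_sub (d : measure_display) (T : measurableType d)
    (G : set (set T)) :
  sigma_algebra setT G -> G `<=` measurable ->
  measurable_fun setT (idfun : T -> g_sigma_algebraType G).
Proof.
move=> sG Gm _ B; rewrite (measurable_g_measurableTypeE sG) setTI => /Gm.
by rewrite preimage_id.
Qed.

Lemma measurable_fun_sub (d d' : measure_display) (T : measurableType d)
    (T' : sigmaRingType d') (G : set (set T)) (f : T -> T') :
  sigma_algebra setT G -> G `<=` measurable ->
  measurable_fun setT (f : g_sigma_algebraType G -> T') ->
  measurable_fun setT f.
Proof.
move=> sG Gm mf _ B mB; apply: Gm.
by rewrite -(measurable_g_measurableTypeE sG); exact: mf.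
Qed.

(** The charge A |-> E(X 1_A), restricted to [G], is dominated by the restriction
    of [P] to [G]; its Radon-Nikodym derivative there is a version of E(X | G).
    The restriction to [G] is encoded as the image under the identity map onto
    the measurable space generated by [G]. *)
Lemma is_condexp_exists (R : realType) (d : measure_display)
    (T : measurableType d) (P : probability T R) (G : set (set T))
    (X : T -> R) :
  sigma_algebra setT G -> G `<=` measurable ->
  P.-integrable setT (EFin \o X) -> exists Y, is_condexp P G X Y.
Proof.
move=> sG Gm iX; pose T' := g_sigma_algebraType G.
have mG := measurable_g_measurableTypeE sG.
have mid := measurable_idfun_sub sG Gm.
pose mix := isMeasurableFun.Build _ _ _ _ _ mid.
pose ind : {mfun T >-> T'} := HB.pack (idfun : T -> T') mix.
pose P' := distribution P ind.
(* The charge structure of an image set function depends on a proof that the map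
   is measurable, so that [pnu] is a function of such a proof. *)
pose pnu : {charge set T' -> \bar R} :=
  pushforward (induced_charge iX) ind.
pose nu := pnu mid.
have numu : nu `<< P'.
  apply/null_content_dominatesP => A mA PA0.
  have mA' : d.-measurable (A : set T) by apply: Gm; rewrite -mG.
  apply: null_set_integral => //.
  exact: measurable_funTS (measurable_int _ iX).
pose Z := Radon_Nikodym nu P'.
have Zfin x : Z x \is a fin_num by exact: Radon_Nikodym_fin_num.
have iZ : P'.-integrable setT Z by exact: Radon_Nikodym_integrable.
have mZ := measurable_int _ iZ.
have ZE : EFin \o (fine \o Z) = Z by apply/funext => x /=; rewrite fineK.
have iZP : P.-integrable setT Z.
  apply/integrableP; split.
    exact: (measurable_fun_sub sG Gm mZ).
  move/integrableP : iZ => [_]; rewrite ge0_integral_pushforward//.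
  exact: measurableT_comp.
exists (fine \o Z); split.
- apply/(measurable_wrtP _ sG)/measurable_EFinP.
  by rewrite ZE.
- by rewrite ZE.
- move=> A GA; have mA : (measurable : set (set T')) A by rewrite mG.
  rewrite -[RHS]/(nu A) (Radon_Nikodym_integral numu mA) -/Z.
  rewrite (@integral_pushforward _ _ _ _ _ _ mid P A Z)//.
    by apply: eq_integral => x _ /=; rewrite fineK.
  exact: (integrableS measurableT (Gm _ GA) _ iZP).
Qed.

Lemma condexpP (R : realType) (d : measure_display)
    (T : measurableType d) (P : probability T R) (G : set (set T))
    (X : T -> R) :
  sigma_algebra setT G -> G `<=` measurable ->
  P.-integrable setT (EFin \o X) -> is_condexp P G X (condexp P G X).
Proof.
move=> sG Gm iX; have [Y hY] := is_condexp_exists sG Gm iX.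
exact: (xgetPex (fun=> 0) (ex_intro [set Y | is_condexp P G X Y] Y hY)).
Qed.

(** * Weights measurable with respect to a sub-sigma-field *)

Lemma integral_simple_weight (d : measure_display) (T : measurableType d)
    (R : realType) (P : {measure set T -> \bar R}) (d' : measure_display)
    (T' : measurableType d') (i : T -> T') (h : {nnsfun T' >-> R})
    (f : T -> \bar R) :
  measurable_fun setT i -> measurable_fun setT f -> (forall x, 0 <= f x)%E ->
  (\int[P]_x ((h (i x))%:E * f x) =
   \sum_(k \in range h) k%:E * \int[P]_(x in i @^-1` (h @^-1` [set k])) f x)%E.
Proof.
move=> mi mf f0.
have mpre k : d.-measurable (i @^-1` (h @^-1` [set k])).
  by rewrite -[X in measurable X]setTI; apply: mi => //; exact: measurable_funPTI.
transitivity (\int[P]_x (\sum_(k \in range h)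
    (k%:E * (\1_(i @^-1` (h @^-1` [set k])) x)%:E * f x)))%E.
  apply: eq_integral => x _.
  rewrite fimfunE -fsumEFin// ge0_mule_fsuml//.
  by move=> k; rewrite EFinM nnfun_muleindic_ge0.
rewrite ge0_integral_fsum//; last 2 first.
- move=> k; apply: emeasurable_funM => //; apply: emeasurable_funM => //.
  exact/measurable_EFinP/measurable_indic.
- move=> k x _; apply: mule_ge0 => //.
  by have := nnfun_muleindic_ge0 h k (i x).
apply: eq_fsbigr => k /[!inE] -[y _ hk].
have k0 : (0 <= k)%R by rewrite -hk.
under eq_integral do rewrite -muleA.
rewrite ge0_integralZl//; last 2 first.
- apply: emeasurable_funM => //; exact/measurable_EFinP/measurable_indic.
- by move=> x _; apply: mule_ge0 => //; rewrite lee_fin.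
congr (_ * _)%E; rewrite [RHS]integral_mkcond; apply: eq_integral => x _.
rewrite epatch_indic muleC//.
Qed.

(** Integrating a [G]-measurable weight only involves the values of the set
    functions A |-> int_A f on [G]: it holds for simple weights by linearity and
    passes to monotone limits. This replaces the rule that takes a
    [G]-measurable factor out of a conditional expectation. *)
Lemma le_integral_weight (d : measure_display) (T : measurableType d)
    (R : realType) (P : {measure set T -> \bar R}) (G : set (set T))
    (f g Z : T -> R) :
  sigma_algebra setT G -> G `<=` measurable ->
  measurable_fun setT f -> measurable_fun setT g ->
  (forall x, 0 <= f x) -> (forall x, 0 <= g x) ->
  (forall A, G A ->
    \int[P]_(x in A) (f x)%:E <= \int[P]_(x in A) (g x)%:E)%E ->
  measurable_wrt G Z -> (forall x, 0 <= Z x) ->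
  (\int[P]_x (Z x * f x)%:E <= \int[P]_x (Z x * g x)%:E)%E.
Proof.
move=> sG Gm mf mg f0 g0 fg /(measurable_wrtP _ sG) mZ Z0.
have mG := measurable_g_measurableTypeE sG.
have mid := measurable_idfun_sub sG Gm.
have mEZ : measurable_fun setT (EFin \o Z : g_sigma_algebraType G -> \bar R).
  exact/measurable_EFinP.
pose h := nnsfun_approx measurableT mEZ.
have approx (u : T -> R) : measurable_fun setT u -> (forall x, 0 <= u x) ->
    (\int[P]_x ((h n x)%:E * (u x)%:E) @[n --> \oo] -->
     \int[P]_x (Z x * u x)%:E)%E.
  move=> mu u0.
  rewrite (_ : (fun x => (Z x * u x)%:E) =
      (fun x => limn (fun n => ((h n x)%:E * (u x)%:E)%E))).
    apply: (@cvg_monotone_convergence _ _ _ P setT measurableT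
      (fun n x => ((h n x)%:E * (u x)%:E)%E)).
    - move=> n; apply: emeasurable_funM; last exact/measurable_EFinP.
      apply/measurable_EFinP.
      exact: (measurable_fun_sub sG Gm (measurable_funP (h n))).
    - by move=> n x _; apply: mule_ge0; rewrite lee_fin.
    - move=> x _ m n mn; apply: lee_wpmul2r; rewrite lee_fin//.
      exact/lefP/(nd_nnsfun_approx measurableT mEZ).
  apply/funext => x; apply/esym/cvg_lim => //.
  rewrite EFinM; apply: cvgeZr => //.
  by apply: (cvg_nnsfun_approx measurableT mEZ) => // y _; rewrite /= lee_fin.
apply: (lee_cvg_to (approx f mf f0) (approx g mg g0)); apply: nearW => n.
have simple (u : T -> R) : measurable_fun setT u -> (forall x, 0 <= u x) ->
    (\int[P]_x ((h n x)%:E * (u x)%:E) =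
     \sum_(k \in range (h n)) k%:E * \int[P]_(x in h n @^-1` [set k]) (u x)%:E)%E.
  move=> /measurable_EFinP mu u0.
  by apply: (integral_simple_weight P (h n) mid mu) => x; rewrite lee_fin.
rewrite !simple//.
rewrite !fsbig_finite//= !big_seq; apply: lee_sum => k.
rewrite in_fset_set// inE => -[y _ <-].
apply: lee_wpmul2l; first by rewrite lee_fin.
apply: fg; have := measurable_funPTI (h n) (measurable_set1 (h n y)).
by rewrite [X in X _ -> _]mG.
Qed.

(** * Exponential moments from power moments *)

(** The terms of order k + 3 are at most t^2/2 V u^(k+1) with u = |t| e, because
    the factorials cancel; the bound is the sum of the geometric series. *)
Lemma norm_exp_sum_moments_le (R : realType) (m : nat -> R) (e V t : R) N :
  0 <= e -> 0 <= V -> `|t| * e < 1 -> m 1%N = 0 -> m 2 = V ->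
  (forall k, (3 <= k)%N -> `|m k| <= 2^-1 * k`!%:R * e ^+ (k - 2) * V) ->
  `|\sum_(0 <= k < N.+3) t ^+ k / k`!%:R * m k - (m 0%N + t ^+ 2 / 2 * V)|
    <= t ^+ 2 / 2 * V * (`|t| * e / (1 - `|t| * e)).
Proof.
move=> e0 V0 te m1 m2 mk; set u := `|t| * e.
have u0 : 0 <= u by rewrite mulr_ge0.
have u1 : 0 < 1 - u by rewrite subr_gt0.
rewrite !big_nat_recl// m1 m2 mulr0 add0r !factS fact0 !muln1 expr0 mul1r invr1 mul1r.
rewrite opprD addrACA subrr add0r addrAC subrr add0r.
apply: le_trans (ler_norm_sum _ _ _) _.
have geo : \sum_(0 <= i < N) u ^+ i <= (1 - u)^-1.
  rewrite -[leRHS]mul1r ler_pdivlMr// big_mkord mulrC -[1 - u]opprB mulNr -subrX1.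
  by rewrite opprB gerBl exprn_ge0.
apply: (@le_trans _ _ (\sum_(0 <= i < N) t ^+ 2 / 2 * V * u * u ^+ i)).
  apply: ler_sum => i _.
  rewrite normrM normrM normfV normrX [`|_`!%:R|]ger0_norm//.
  have f0 : 0 < (i.+3)`!%:R :> R by rewrite ltr0n fact_gt0.
  apply: (@le_trans _ _ (`|t| ^+ i.+3 / i.+3`!%:R * (2^-1 * i.+3`!%:R * e ^+ i.+1 * V))).
    rewrite ler_wpM2l//.
    by have := mk i.+3 isT; rewrite !subSS subn0.
  rewrite -(real_normK (num_real t)) le_eqVlt; apply/orP; left; apply/eqP.
  rewrite /u exprMn !exprS; field; exact: lt0r_neq0.
rewrite -mulr_sumr [leRHS]mulrA ler_wpM2l//.
by apply: mulr_ge0 => //; apply: mulr_ge0 => //; rewrite divr_ge0 ?sqr_ge0.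
Qed.

(** Reverse of 1 + y <= exp y for small y: exp (y - y^2) <= 1 / (1 - y + y^2), and
    (1 + y) (1 - y + y^2) = 1 + y^3 >= 1. *)
Lemma expRM_le1D (R : realType) (y s : R) :
  0 <= y <= s -> s <= 1 -> expR (y * (1 - s)) <= 1 + y.
Proof.
move=> /andP[y0 ys] s1.
have y1 := le_trans ys s1.
have hu : 0 < 1 - (y * (1 - y)) by nra.
apply: (@le_trans _ _ (expR (y * (1 - y)))).
  by rewrite ler_expR ler_wpM2l// lerB.
rewrite -[y * (1 - y)]opprK expRN.
have /le_trans : (expR (- (y * (1 - y))))^-1 <= (1 - y * (1 - y))^-1.
  by rewrite lef_pV2 ?posrE ?expR_gt0// expR_ge1Dx.
apply.
rewrite -[(1 - _)^-1]mul1r ler_pdivrMr//; nra.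
Qed.

Section integral_comparison.
Context (d : measure_display) (T : measurableType d) (R : realType)
  (P : {measure set T -> \bar R}) (D : set T).
Hypothesis mD : measurable D.
Implicit Types f g : T -> R.

(** As f >= 0, g agrees almost everywhere with its positive part, so that the
    comparison of nonnegative functions applies. *)
Lemma ae_le_integral_ge0l f g :
  measurable_fun D f -> P.-integrable D (EFin \o g) ->
  (forall x, 0 <= f x) -> {ae P, forall x, f x <= g x} ->
  (\int[P]_(x in D) (f x)%:E <= \int[P]_(x in D) (g x)%:E)%E.
Proof.
move=> mf ig f0 fg; have mg := measurable_int _ ig.
rewrite [leRHS](_ : _ = \int[P]_(x in D) ((EFin \o g)^\+ x))%E.
  apply: ae_ge0_le_integral => //.
  - by move=> x _; rewrite lee_fin.
  - exact/measurable_EFinP.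
  - exact: measurable_funepos.
  - apply: filterS fg => x fgx _.
    by rewrite funeposE le_max lee_fin fgx.
apply: ae_eq_integral => //; first exact: measurable_funepos.
apply: filterS fg => x fgx _; rewrite funeposE/= max_l// lee_fin.
exact: le_trans fgx.
Qed.

Lemma le_integral_ge0r f g :
  P.-integrable D (EFin \o f) -> measurable_fun D g ->
  (forall x, 0 <= g x) -> (forall x, f x <= g x) ->
  (\int[P]_(x in D) (f x)%:E <= \int[P]_(x in D) (g x)%:E)%E.
Proof.
move=> If mg g0 fg; apply: (@le_trans _ _ (\int[P]_(x in D) ((EFin \o f)^\+ x))%E).
  apply: le_integral => //; first exact: integrable_funepos.
  by move=> x _; rewrite funeposE le_max lexx.
apply: ge0_le_integral => //.
- exact: measurable_funepos (measurable_int _ If).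
- exact/measurable_EFinP.
- by move=> x _; rewrite funeposE ge_max !lee_fin fg g0.
Qed.

Lemma ae_le_Rintegral f g :
  P.-integrable D (EFin \o f) -> P.-integrable D (EFin \o g) ->
  {ae P, forall x, f x <= g x} ->
  \int[P]_(x in D) f x <= \int[P]_(x in D) g x.
Proof.
move=> If Ig fg; rewrite -subr_ge0 -RintegralB// -lee_fin.
have Igf : P.-integrable D (EFin \o (g \- f)).
  by have := integrableB mD Ig If; apply: eq_integrable.
rewrite /Rintegral fineK; last exact: integrable_fin_num.
apply: (@le_trans _ _ (\int[P]_(x in D) (cst 0 x)%:E)%E); first exact: integral_ge0.
apply: (@ae_le_integral_ge0l (cst 0) (g \- f)) => //.
by apply: filterS fg => x fgx /=; rewrite subr_ge0.
Qed.

End integral_comparison.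

Section power_series_integral.
Context (d : measure_display) (T : measurableType d) (R : realType)
  (P : {measure set T -> \bar R}) (X : T -> R).
Hypothesis mX : measurable_fun setT X.
Hypothesis iX : forall k, P.-integrable setT (fun x => (X x ^+ k)%:E).

Lemma integrable_series_exp_coeff t N :
  P.-integrable setT (fun x => (series (exp_coeff (t * X x)) N)%:E).
Proof.
rewrite (_ : (fun x => _) =
    (fun x => \sum_(0 <= k < N) (t ^+ k / k`!%:R)%:E * (X x ^+ k)%:E)%E).
  by apply: integrable_sum => // k _; exact: integrableZl.
apply/funext => x; rewrite /series/= -sumEFin; apply: eq_bigr => k _.
by rewrite /exp_coeff/= exprMn -EFinM; congr EFin; ring.
Qed.

Lemma Rintegral_series_exp_coeff (A : set T) t N : measurable A ->
  \int[P]_(x in A) (series (exp_coeff (t * X x)) N) =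
  \sum_(0 <= k < N) t ^+ k / k`!%:R * \int[P]_(x in A) (X x ^+ k).
Proof.
move=> mA; elim: N => [|N IH].
  rewrite big_geq// /Rintegral; under eq_integral do rewrite /series/= big_geq//.
  by rewrite integral0.
rewrite big_nat_recr//= -IH -RintegralZl//; last exact: integrableS (iX N).
rewrite -RintegralD//; last 2 first.
- exact: integrableS (integrable_series_exp_coeff t N).
- apply: (integrableS measurableT) => //.
  by have := integrableZl measurableT (t ^+ N / N`!%:R) (iX N); apply: eq_integrable.
apply: eq_Rintegral => x _.
by rewrite seriesSr /exp_coeff/= exprMn; congr +%R; ring.
Qed.

(** The odd terms cancel in the series of exp (t X) + exp (- t X) and the even
    ones are nonnegative, so monotone convergence applies to its partial sums
    although those of exp (t X) alone need not be monotone. *)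
Lemma integrable_expR_of_moments t C :
  (forall N, \int[P]_x series (exp_coeff (t * X x)) N.+3 <= C) ->
  (forall N, \int[P]_x series (exp_coeff (- t * X x)) N.+3 <= C) ->
  P.-integrable setT (fun x => (expR `|t * X x|)%:E).
Proof.
move=> hp hn.
pose f N x := series (exp_coeff (t * X x)) N + series (exp_coeff (- t * X x)) N.
have fE N x : f N x = \sum_(0 <= k < N) (exp_coeff (t * X x) k + exp_coeff (- t * X x) k).
  by rewrite big_split.
have term_ge0 (y : R) k : 0 <= exp_coeff y k + exp_coeff (- y) k.
  rewrite /exp_coeff/= -mulrDl divr_ge0// exprNn; case: (boolP (odd k)) => ok.
    by rewrite -signr_odd ok expr1 mulN1r subrr.
  rewrite -signr_odd (negbTE ok) expr0 mul1r -mulr2n mulrn_wge0//.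
  by apply: exprn_even_ge0.
have If N : P.-integrable setT (EFin \o f N).
  have := integrableD measurableT (integrable_series_exp_coeff t N)
    (integrable_series_exp_coeff (- t) N).
  by apply: eq_integrable.
have mf N : measurable_fun setT (EFin \o f N) by exact: measurable_int (If N).
have flim x : (f N x)%:E @[N --> \oo] --> (expR (t * X x) + expR (- t * X x))%:E.
  apply: cvg_EFin; first exact: nearW.
  apply: cvgD; exact: is_cvg_series_exp_coeff.
apply/integrableP; split.
  apply/measurable_EFinP; apply: measurableT_comp => //.
  apply: measurableT_comp => //; exact: measurable_funM.
apply: (@le_lt_trans _ _ (C + C)%:E); last exact: ltry.
apply: (@le_trans _ _ (\int[P]_x (expR (t * X x) + expR (- t * X x))%:E)%E).
  apply: ge0_le_integral => //.
  - apply/measurable_EFinP/measurableT_comp => //.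
    by apply: measurableT_comp => //; apply: measurableT_comp => //; exact: measurable_funM.
  - by apply/measurable_EFinP/measurable_funD; apply: measurableT_comp => //;
      exact: measurable_funM.
  - move=> x _; rewrite /= lee_fin ger0_norm ?expR_ge0// mulNr.
    by case: (ger0P (t * X x)) => _; rewrite ?lerDl ?lerDr expR_ge0.
have intlim : (\int[P]_x (EFin \o f N) x @[N --> \oo] -->
    \int[P]_x (expR (t * X x) + expR (- t * X x))%:E)%E.
  rewrite (_ : (fun x => (_ + _)%:E) = (fun x => limn (fun N => (EFin \o f N) x))).
    apply: cvg_monotone_convergence => //.
    - by move=> N x _ /=; rewrite lee_fin fE sumr_ge0// => k _; rewrite mulNr.
    - move=> x _ m n mn; rewrite /= lee_fin !fE [leRHS](big_cat_nat _ (n := m))//=.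
      by rewrite lerDl sumr_ge0// => k _; rewrite mulNr.
  by apply/funext => x; apply/esym/cvg_lim => //; exact: flim.
apply: cvge_le intlim; exists 3 => // -[|[|[|N]]]// _.
have -> : (\int[P]_x (EFin \o f N.+3) x = (\int[P]_x f N.+3 x)%:E)%E.
  by rewrite /Rintegral fineK//; exact: (integrable_fin_num measurableT (If N.+3)).
by rewrite lee_fin /f RintegralD//; [rewrite lerD|exact: integrable_series_exp_coeff..].
Qed.

End power_series_integral.

Lemma le_norm_series_exp_coeff (R : realType) (y : R) N :
  `|series (exp_coeff y) N| <= expR `|y|.
Proof.
apply: (@le_trans _ _ (series (exp_coeff `|y|) N)).
  rewrite /series/=; apply: le_trans (ler_norm_sum _ _ _) _.
  apply: ler_sum => k _.
  by rewrite /exp_coeff/= normrM normrX normfV [`|_`!%:R|]ger0_norm.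
apply: nondecreasing_cvgn_le; last exact: is_cvg_series_exp_coeff.
move=> m n mn; rewrite /series/= [leRHS](big_cat_nat _ (n := m))//=.
by rewrite lerDl sumr_ge0// => k _; exact: exp_coeff_ge0.
Qed.

Lemma cvg_integral_series_exp_coeff (d : measure_display)
    (T : measurableType d) (R : realType) (P : {measure set T -> \bar R})
    (X : T -> R) (t : R) (A : set T) :
  measurable A -> measurable_fun setT X ->
  P.-integrable setT (fun x => (expR `|t * X x|)%:E) ->
  (\int[P]_(x in A) (series (exp_coeff (t * X x)) N)%:E @[N --> \oo] -->
   \int[P]_(x in A) (expR (t * X x))%:E)%E.
Proof.
move=> mA mX iE.
have mtX : measurable_fun setT (fun x => t * X x) by exact: measurable_funM.
have [] // := @dominated_convergence _ _ _ P A mA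
  (fun N x => (series (exp_coeff (t * X x)) N)%:E)
  (fun x => (expR (t * X x))%:E) (fun x => (expR `|t * X x|)%:E).
- move=> N; apply/measurable_EFinP; apply: measurable_funTS.
  rewrite /series/=; apply: measurable_sum => k.
  by apply: measurable_funM => //; exact: measurable_funX.
- by apply/measurable_EFinP; apply: measurable_funTS; exact: measurableT_comp.
- apply: aeW => x Ax; apply: cvg_EFin; first exact: nearW.
  exact: is_cvg_series_exp_coeff.
- exact: integrableS iE.
- by apply: aeW => x N Ax; rewrite /= lee_fin le_norm_series_exp_coeff.
Qed.

(** * One martingale difference under the conditional Bernstein condition *)

Section conditional_bernstein_mgf.
Context (R : realType) (d : measure_display) (T : measurableType d)
  (P : probability T R) (G : set (set T)) (X : T -> R) (e : R).
Hypothesis sG : sigma_algebra setT G.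
Hypothesis Gm : G `<=` measurable.
Hypothesis mX : measurable_fun setT X.
Hypothesis iX2 : P.-integrable setT (fun x => (X x ^+ 2)%:E).
Hypothesis centered : {ae P, forall x, condexp P G X x = 0}.
Hypothesis e0 : 0 < e.
Let v := condexp P G (fun x => X x ^+ 2).
Hypothesis bernstein : forall k, (3 <= k)%N ->
  P.-integrable setT (fun x => (X x ^+ k)%:E) /\
  {ae P, forall x, `|condexp P G (fun x' => X x' ^+ k) x| <=
                     2^-1 * k`!%:R * e ^+ (k - 2) * v x}.

Lemma integrable_pow k : P.-integrable setT (fun x => (X x ^+ k)%:E).
Proof.
case: k => [|[|[|k]]].
- by under eq_fun do rewrite expr0; exact: finite_measure_integrable_cst.
- have i1 : P.-integrable setT (fun=> 1%E) by exact: finite_measure_integrable_cst.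
  apply: le_integrable (integrableD measurableT i1 iX2) => //.
    exact/measurable_EFinP/measurable_funX.
  move=> x _; rewrite -EFinD/= lee_fin expr1 [leRHS]ger0_norm; last first.
    by rewrite addr_ge0// sqr_ge0.
  rewrite ler_norml; nra.
- exact: iX2.
- by have [] := bernstein (isT : (3 <= k.+3)%N).
Qed.

Lemma is_condexp_pow k :
  is_condexp P G (fun x => X x ^+ k) (condexp P G (fun x => X x ^+ k)).
Proof. by apply: condexpP => //; exact: integrable_pow. Qed.

Lemma integrable_cvar : P.-integrable setT (EFin \o v).
Proof. by have [] := is_condexp_pow 2. Qed.

Lemma measurable_cvar : measurable_fun setT v.
Proof. by apply/measurable_EFinP; exact: measurable_int integrable_cvar. Qed.

(** The Bernstein condition at k = 3 bounds an absolute value by a positive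
    multiple of [v]. *)
Lemma cvar_ge0 : {ae P, forall x, 0 <= v x}.
Proof.
have [_] := bernstein (isT : (3 <= 3)%N); apply: filterS => x.
move=> /(le_trans (normr_ge0 _)); rewrite pmulr_rge0//.
by rewrite !mulr_gt0// ?ltr0n ?fact_gt0// exprn_gt0.
Qed.

Lemma Rintegral_condexp_pow k (A : set T) : G A ->
  \int[P]_(x in A) condexp P G (fun x => X x ^+ k) x = \int[P]_(x in A) (X x ^+ k).
Proof. by move=> GA; have [_ _ h] := is_condexp_pow k; rewrite /Rintegral h. Qed.

Lemma Rintegral_sqr (A : set T) : G A ->
  \int[P]_(x in A) (X x ^+ 2) = \int[P]_(x in A) v x.
Proof. by move=> GA; rewrite -Rintegral_condexp_pow. Qed.

Lemma Rintegral_pow1 (A : set T) : G A -> \int[P]_(x in A) (X x ^+ 1) = 0.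
Proof.
move=> GA; rewrite -Rintegral_condexp_pow// /Rintegral.
rewrite (_ : (\int[P]_(x in A) _)%E = 0%E)//.
have [_ i1 _] := is_condexp_pow 1; have mA := Gm GA.
rewrite (_ : (fun x => X x ^+ 1) = X) in i1 *; last by apply/funext => x; rewrite expr1.
rewrite -[RHS](@integral0 _ _ _ P A); apply: ae_eq_integral => //.
  exact: measurable_funTS (measurable_int _ i1).
by apply: filterS centered => x cx _; rewrite cx.
Qed.

Lemma cvar_Rintegral_ge0 (A : set T) : G A -> 0 <= \int[P]_(x in A) v x.
Proof.
by move=> GA; rewrite -Rintegral_sqr//; apply: Rintegral_ge0 => x _; exact: sqr_ge0.
Qed.

Lemma norm_Rintegral_pow_le k (A : set T) : G A -> (3 <= k)%N ->
  `|\int[P]_(x in A) (X x ^+ k)| <=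
    2^-1 * k`!%:R * e ^+ (k - 2) * \int[P]_(x in A) v x.
Proof.
move=> GA k3; rewrite -Rintegral_condexp_pow//.
have [_ ik _] := is_condexp_pow k; have mA := Gm GA.
have ikA := integrableS measurableT mA (@subsetT _ _) ik.
have ivA := integrableS measurableT mA (@subsetT _ _) integrable_cvar.
apply: le_trans (le_normr_Rintegral mA ikA) _.
rewrite -RintegralZl//; apply: ae_le_Rintegral => //.
- exact: integrable_norm.
- by have := integrableZl mA (2^-1 * k`!%:R * e ^+ (k - 2)) ivA; apply: eq_integrable.
- by have [] := bernstein k3.
Qed.

(** With c = 12 e^2, the inequality X^2 <= X^4 / (2c) + c/2 and the Bernstein
    condition at k = 4, which reads E(X^4 | G) <= c v, give v <= v/2 + c/2 in
    integrated form. *)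
Lemma cvar_Rintegral_le (A : set T) : G A ->
  \int[P]_(x in A) v x <= 12 * e ^+ 2 * fine (P A).
Proof.
move=> GA; have mA := Gm GA; pose c := 12 * e ^+ 2.
have c0 : 0 < c by rewrite mulr_gt0// exprn_gt0.
have iA k := integrableS measurableT mA (@subsetT _ _) (integrable_pow k).
have i4 : P.-integrable A (fun x => ((2 * c)^-1 * X x ^+ 4)%:E).
  by have := integrableZl mA (2 * c)^-1 (iA 4); apply: eq_integrable.
have ic : P.-integrable A (EFin \o cst (c / 2)).
  exact: finite_measure_integrable_cst.
have le1 : \int[P]_(x in A) (X x ^+ 2) <=
    \int[P]_(x in A) ((2 * c)^-1 * X x ^+ 4 + c / 2).
  apply: ae_le_Rintegral => //.
  - exact: (iA 2).
  - by have := integrableD mA i4 ic; apply: eq_integrable.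
  apply: aeW => x; rewrite -subr_ge0.
  rewrite (_ : _ - _ = (2 * c)^-1 * (X x ^+ 2 - c) ^+ 2).
    apply: mulr_ge0; last exact: sqr_ge0.
    by rewrite invr_ge0 mulr_ge0// ltW.
  by field; exact: lt0r_neq0.
rewrite RintegralD// Rintegral_cst// (RintegralZl _ mA (iA 4)) Rintegral_sqr// in le1.
have := norm_Rintegral_pow_le GA (isT : (3 <= 4)%N).
move=> /(le_trans (ler_norm _)); rewrite (_ : 4`! = 24)//.
set V := \int[P]_(x in A) v x in le1 *; set M := \int[P]_(x in A) (X x ^+ 4) in le1 *.
move=> le2.
have : (2 * c)^-1 * M <= V / 2.
  rewrite mulrC ler_pdivrMr ?mulr_gt0//; apply: le_trans le2 _.
  by rewrite /c le_eqVlt; apply/orP; left; apply/eqP; field.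
move: le1; rewrite -/c; nra.
Qed.

(** Integrate over the event that [v] exceeds the bound, which belongs to [G]. *)
Lemma cvar_le : {ae P, forall x, v x <= 12 * e ^+ 2}.
Proof.
pose c := 12 * e ^+ 2; pose A := [set x | c < v x].
have GA : G A.
  rewrite (_ : A = v @^-1` `]c, +oo[%classic).
    by have [h _ _] := is_condexp_pow 2; apply: h; exact: measurable_itv.
  by apply/seteqP; split => x; rewrite /A/= in_itv/= andbT.
have mA := Gm GA.
have ivA := integrableS measurableT mA (@subsetT _ _) integrable_cvar.
have ic : P.-integrable A (EFin \o cst c) by exact: finite_measure_integrable_cst.
have ivc : P.-integrable A (EFin \o (v \- cst c)).
  by have := integrableB mA ivA ic; apply: eq_integrable.
have le0 : \int[P]_(x in A) (v x - c) <= 0.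
  by rewrite RintegralB// Rintegral_cst// subr_le0 cvar_Rintegral_le.
have : (\int[P]_(x in A) `|(v x - c)%:E| = 0)%E.
  rewrite (_ : (\int[P]_(x in A) _ = \int[P]_(x in A) (v x - c)%:E)%E).
    apply/eqP; rewrite eq_le; apply/andP; split; last first.
      by apply: integral_ge0 => x Ax; rewrite lee_fin subr_ge0 ltW.
    by rewrite -[leLHS]fineK ?lee_fin//; exact: (integrable_fin_num mA ivc).
  apply: eq_integral => x /[!inE] Ax.
  by rewrite gee0_abs// lee_fin subr_ge0 ltW.
move=> /(ae_eq_integral_abs P mA (measurable_int _ ivc)).
apply: filterS => x h; rewrite leNgt; apply/negP => Ax.
by have := h Ax => -[] /eqP; rewrite subr_eq0 => /eqP vc; move: Ax; rewrite vc ltxx.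
Qed.

Lemma integrable_expR_norm t : `|t| * e < 1 ->
  P.-integrable setT (fun x => (expR `|t * X x|)%:E).
Proof.
move=> te; have GT : G setT by rewrite -(measurable_g_measurableTypeE sG).
pose m k := \int[P]_(x in setT) (X x ^+ k).
pose C := m 0%N + t ^+ 2 / 2 * m 2 + t ^+ 2 / 2 * m 2 * (`|t| * e / (1 - `|t| * e)).
have bound s N : `|s| = `|t| ->
    \int[P]_x series (exp_coeff (s * X x)) N.+3 <= C.
  move=> st; have st2 : s ^+ 2 = t ^+ 2.
    by rewrite -(real_normK (num_real s)) st real_normK ?num_real.
  rewrite (Rintegral_series_exp_coeff integrable_pow)// /C -st -st2 -/(m _).
  rewrite -lerBlDl; apply: le_trans (ler_norm _) _.
  apply: norm_exp_sum_moments_le => //.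
  - exact: ltW.
  - by rewrite /m Rintegral_sqr// cvar_Rintegral_ge0.
  - by rewrite st.
  - exact: Rintegral_pow1.
  - by move=> k k3; rewrite [m 2]Rintegral_sqr//; exact: norm_Rintegral_pow_le.
apply: (integrable_expR_of_moments (C := C) mX integrable_pow) => N; apply: bound => //.
by rewrite normrN.
Qed.

(** The moments of [X] over an event of [G] satisfy the hypotheses of
    [norm_exp_sum_moments_le]; dominated convergence passes to the full series. *)
Lemma integral_expR_bounds t (A : set T) (V := \int[P]_(x in A) v x)
    (th := `|t| * e / (1 - `|t| * e)) :
  `|t| * e < 1 -> G A ->
  ((fine (P A) + t ^+ 2 / 2 * (1 - th) * V)%:E <=
     \int[P]_(x in A) (expR (t * X x))%:E <=
   (fine (P A) + t ^+ 2 / 2 * (1 + th) * V)%:E)%E.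
Proof.
move=> te GA; have mA := Gm GA.
have cv := cvg_integral_series_exp_coeff mA mX (integrable_expR_norm te).
have m0 : \int[P]_(x in A) (X x ^+ 0) = fine (P A).
  by under eq_Rintegral do rewrite expr0; rewrite Rintegral_cst// mul1r.
have bound N : `|\int[P]_(x in A) series (exp_coeff (t * X x)) N.+3 -
    (fine (P A) + t ^+ 2 / 2 * V)| <= t ^+ 2 / 2 * V * th.
  rewrite (Rintegral_series_exp_coeff integrable_pow)// -m0.
  apply: (@norm_exp_sum_moments_le _ (fun k => \int[P]_(x in A) (X x ^+ k))) => //.
  - exact: ltW.
  - exact: cvar_Rintegral_ge0.
  - exact: Rintegral_pow1.
  - exact: Rintegral_sqr.
  - by move=> k k3; exact: norm_Rintegral_pow_le.
have E N : (\int[P]_(x in A) (series (exp_coeff (t * X x)) N)%:E =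
    (\int[P]_(x in A) series (exp_coeff (t * X x)) N)%:E)%E.
  rewrite /Rintegral fineK//; apply: integrable_fin_num => //.
  apply: integrableS (integrable_series_exp_coeff integrable_pow t N) => //.
apply/andP; split.
  apply: cvge_ge cv; exists 3 => // -[|[|[|N]]]// _; rewrite E lee_fin.
  by have := bound N; rewrite ler_norml => /andP[+ _]; rewrite mulrBr mulr1; lra.
apply: cvge_le cv; exists 3 => // -[|[|[|N]]]// _; rewrite E lee_fin.
by have := bound N; rewrite ler_norml => /andP[_]; rewrite mulrDr mulr1; lra.
Qed.

Lemma integral_affine_cvar c (A : set T) : G A ->
  P.-integrable A (fun x => (1 + c * v x)%:E) /\
  (\int[P]_(x in A) (1 + c * v x)%:E =
   (fine (P A) + c * \int[P]_(x in A) v x)%:E)%E.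
Proof.
move=> GA; have mA := Gm GA.
have ivA := integrableS measurableT mA (@subsetT _ _) integrable_cvar.
have icv : P.-integrable A (EFin \o (fun x => c * v x)).
  by have := integrableZl mA c ivA; apply: eq_integrable.
have i1 : P.-integrable A (EFin \o cst 1) by exact: finite_measure_integrable_cst.
have i1cv : P.-integrable A (fun x => (1 + c * v x)%:E).
  by have := integrableD mA i1 icv; apply: eq_integrable.
split => //; rewrite -[LHS]fineK; last exact: (integrable_fin_num mA i1cv).
rewrite -[fine _]/(\int[P]_(x in A) (1 + c * v x)) RintegralD//.
by rewrite Rintegral_cst// mul1r RintegralZl.
Qed.

Lemma integral_expR_le t (A : set T) (th := `|t| * e / (1 - `|t| * e)) :
  `|t| * e < 1 -> G A ->
  (\int[P]_(x in A) (expR (t * X x))%:E <=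
   \int[P]_(x in A) (expR (t ^+ 2 / 2 * (1 + th) * v x))%:E)%E.
Proof.
move=> te GA.
have /andP[_ /le_trans] := integral_expR_bounds te GA; apply.
have [i1 <-] := integral_affine_cvar (t ^+ 2 / 2 * (1 + th)) GA.
apply: le_integral_ge0r => //; first exact: Gm.
- apply: measurable_funTS; apply: measurableT_comp => //.
  by apply: measurable_funM => //; exact: measurable_cvar.
- by move=> x; exact: expR_ge1Dx.
Qed.

(** Here y = t^2/2 (1 - th) v lies between 0 and s almost surely, which makes
    [expRM_le1D] applicable. *)
Lemma integral_expR_ge t (A : set T) (th := `|t| * e / (1 - `|t| * e))
    (s := 6 * t ^+ 2 * e ^+ 2) :
  `|t| * e < 1 -> th <= 1 -> s <= 1 -> G A ->
  (\int[P]_(x in A) (expR (t ^+ 2 / 2 * (1 - th) * (1 - s) * v x))%:E <=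
   \int[P]_(x in A) (expR (t * X x))%:E)%E.
Proof.
move=> te th1 s1 GA.
have /andP[+ _] := integral_expR_bounds te GA; apply: le_trans.
have [i1 <-] := integral_affine_cvar (t ^+ 2 / 2 * (1 - th)) GA.
apply: ae_le_integral_ge0l => //; first exact: Gm.
- apply: measurable_funTS; apply: measurableT_comp => //.
  by apply: measurable_funM => //; exact: measurable_cvar.
- have t2 : 0 <= t ^+ 2 / 2 by rewrite divr_ge0// sqr_ge0.
  have th0 : 0 <= th.
    apply: divr_ge0; last by rewrite subr_ge0 ltW.
    by apply: mulr_ge0 => //; exact: ltW.
  apply: filterS2 cvar_ge0 cvar_le => x vx0 vxc.
  rewrite mulrAC; apply: expRM_le1D => //; apply/andP; split.
    by rewrite mulr_ge0// mulr_ge0// subr_ge0.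
  rewrite (_ : s = t ^+ 2 / 2 * 1 * (12 * e ^+ 2)); last by rewrite /s; field.
  apply: ler_pM => //; first by rewrite mulr_ge0// subr_ge0.
  by rewrite ler_wpM2l// gerBl.
Qed.

End conditional_bernstein_mgf.

Lemma measurable_partial_sum (d : measure_display) (T : measurableType d)
    (R : realType) (h : nat -> T -> R) k :
  (forall j, (1 <= j <= k)%N -> measurable_fun setT (h j)) ->
  measurable_fun setT (fun w => \sum_(1 <= j < k.+1) h j w).
Proof.
elim: k => [|k IH] mh; first by under eq_fun do rewrite big_geq//; exact: measurable_cst.
under eq_fun do rewrite big_nat_recr//=.
apply: measurable_funD; last by apply: mh; rewrite leqnn.
by apply: IH => j /andP[j1 jk]; apply: mh; rewrite j1 ltnW.
Qed.

(** * Exponential super- and submartingales *)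

Section martingale_mgf.
Context (R : realType) (d : measure_display) (T : measurableType d)
  (P : probability T R) (n : nat) (F : nat -> set (set T)) (xi : nat -> T -> R).
Hypothesis md : martingale_differences P n F xi.

Let S i : T -> R := martingale_sum i xi.
Let Q i : T -> R := quadratic_char P i F xi.
Let v i : T -> R := condexp P (F i.-1) (fun w => xi i w ^+ 2).

Lemma filtration_sub i j : (i <= j <= n)%N -> F i `<=` F j.
Proof.
elim: j => [|j IH]; first by rewrite leqn0 => /andP[/eqP -> _]; exact: subset_refl.
case/andP; rewrite leq_eqVlt => /predU1P[-> _|ij jn]; first exact: subset_refl.
have ijn : (i <= j <= n)%N by rewrite -ltnS ij ltnW.
by move=> A /(IH ijn); exact: (md_incr md).
Qed.

Lemma measurable_wrt_le i j (X : T -> R) : (i <= j <= n)%N ->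
  measurable_wrt (F i) X -> measurable_fun setT (X : g_sigma_algebraType (F j) -> R).
Proof.
move=> ijn mX; have /andP[_ jn] := ijn.
apply/(measurable_wrtP _ (md_sigma md jn)) => B /mX; exact: filtration_sub.
Qed.

Lemma measurable_wrt_cvar i : (1 <= i <= n)%N -> measurable_wrt (F i.-1) (v i).
Proof.
move=> /andP[i1 ni]; have pin : (i.-1 <= n)%N by rewrite (leq_trans (leq_pred i)).
by have [] := condexpP (md_sigma md pin) (md_sub md pin) (md_sqint md ni).
Qed.

(** The quadratic characteristic is predictable: its index may be one ahead of
    that of the sigma-field. *)
Lemma measurable_wrt_weight t c i : (i < n)%N ->
  measurable_wrt (F i) (fun w => expR (t * S i w - c * Q i.+1 w)).
Proof.
move=> ni; apply/(measurable_wrtP _ (md_sigma md (ltnW ni))).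
apply: measurableT_comp => //; apply: measurable_funB; apply: measurable_funM => //.
  apply: measurable_partial_sum => j /andP[j1 ji].
  apply: (@measurable_wrt_le j); first by rewrite ji ltnW.
  by apply: (md_adapted md); rewrite (leq_trans ji)// ltnW.
apply: measurable_partial_sum => j /andP[j1 ji].
apply: (@measurable_wrt_le j.-1).
  by rewrite (ltnW ni) andbT -ltnS prednK.
by apply: measurable_wrt_cvar; rewrite j1 (leq_trans ji).
Qed.

Lemma measurable_difference i : (i <= n)%N -> measurable_fun setT (xi i).
Proof.
move=> ni; apply: (measurable_fun_sub (md_sigma md ni) (md_sub md ni)).
exact/(measurable_wrtP _ (md_sigma md ni))/(md_adapted md).
Qed.

Lemma measurable_cond_variance i : (1 <= i <= n)%N -> measurable_fun setT (v i).
Proof.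
move=> /andP[i1 ni]; have pin : (i.-1 <= n)%N by rewrite (leq_trans (leq_pred i)).
apply: (measurable_fun_sub (md_sigma md pin) (md_sub md pin)).
by apply/(measurable_wrtP _ (md_sigma md pin)); apply: measurable_wrt_cvar; rewrite i1.
Qed.

Lemma measurable_martingale_sum i : (i <= n)%N -> measurable_fun setT (S i).
Proof.
move=> ni; apply: measurable_partial_sum => j /andP[_ ji].
by apply: measurable_difference; exact: leq_trans ni.
Qed.

Lemma measurable_quadratic_char i : (i <= n)%N -> measurable_fun setT (Q i).
Proof.
move=> ni; apply: measurable_partial_sum => j /andP[j1 ji].
by apply: measurable_cond_variance; rewrite j1 (leq_trans ji).
Qed.

(** Both exponentials share the F_i-measurable factor exp (t S_i - c Q_(i+1)); the
    remaining factors are those compared by the one-step estimates. *)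
Lemma expR_martingale_factors t c i w :
  expR (t * S i.+1 w - c * Q i.+1 w) =
    expR (t * S i w - c * Q i.+1 w) * expR (t * xi i.+1 w) /\
  expR (t * S i w - c * Q i w) =
    expR (t * S i w - c * Q i.+1 w) * expR (c * v i.+1 w).
Proof.
rewrite -!expRD /S /Q /martingale_sum /quadratic_char !(@big_nat_recr _ _ _ i.+1)//=.
by split; congr expR; rewrite /v; ring.
Qed.

Lemma integral_expR_S0 t c : (\int[P]_w (expR (t * S 0 w - c * Q 0 w))%:E = 1)%E.
Proof.
rewrite /S /Q /martingale_sum /quadratic_char.
under eq_integral do rewrite !big_geq// !mulr0 subr0 expR0.
rewrite integral_cst// mul1e; exact: probability_setT.
Qed.

Lemma integral_expR_supermartingale t c :
  (forall i A, (i < n)%N -> F i A ->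
    \int[P]_(w in A) (expR (t * xi i.+1 w))%:E <=
    \int[P]_(w in A) (expR (c * v i.+1 w))%:E)%E ->
  (\int[P]_w (expR (t * S n w - c * Q n w))%:E <= 1)%E.
Proof.
move=> step.
suff H i : (i <= n)%N ->
    (\int[P]_w (expR (t * S i w - c * Q i w))%:E <= 1)%E by exact: H.
elim: i => [|i IH] ni; first by rewrite integral_expR_S0.
apply: le_trans (IH (ltnW ni)).
under eq_integral do rewrite (expR_martingale_factors t c i _).1.
under [leRHS]eq_integral do rewrite (expR_martingale_factors t c i _).2.
apply: (le_integral_weight (md_sigma md (ltnW ni)) (md_sub md (ltnW ni))).
- by apply: measurableT_comp => //; apply: measurable_funM => //; exact: measurable_difference.
- by apply: measurableT_comp => //; apply: measurable_funM => //; exact: measurable_cond_variance.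
- by move=> w; exact: expR_ge0.
- by move=> w; exact: expR_ge0.
- by move=> A FA; exact: step.
- exact: measurable_wrt_weight.
- by move=> w; exact: expR_ge0.
Qed.

Lemma integral_expR_submartingale t c :
  (forall i A, (i < n)%N -> F i A ->
    \int[P]_(w in A) (expR (c * v i.+1 w))%:E <=
    \int[P]_(w in A) (expR (t * xi i.+1 w))%:E)%E ->
  (1 <= \int[P]_w (expR (t * S n w - c * Q n w))%:E)%E.
Proof.
move=> step.
suff H i : (i <= n)%N ->
    (1 <= \int[P]_w (expR (t * S i w - c * Q i w))%:E)%E by exact: H.
elim: i => [|i IH] ni; first by rewrite integral_expR_S0.
apply: le_trans (IH (ltnW ni)) _.
under eq_integral do rewrite (expR_martingale_factors t c i _).2.
under [leRHS]eq_integral do rewrite (expR_martingale_factors t c i _).1.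
apply: (le_integral_weight (md_sigma md (ltnW ni)) (md_sub md (ltnW ni))).
- by apply: measurableT_comp => //; apply: measurable_funM => //; exact: measurable_cond_variance.
- by apply: measurableT_comp => //; apply: measurable_funM => //; exact: measurable_difference.
- by move=> w; exact: expR_ge0.
- by move=> w; exact: expR_ge0.
- by move=> A FA; exact: step.
- exact: measurable_wrt_weight.
- by move=> w; exact: expR_ge0.
Qed.

Context (e dl : R).
Hypothesis e0 : 0 < e.
Hypothesis A1 : conditional_bernstein P n F xi e.
Hypothesis A2 : quadratic_char_near1 P n F xi dl.

(** As c >= 0 and Q_n <= 1 + dl^2, exp (t S_n) is at most exp (c (1 + dl^2)) times
    the supermartingale exp (t S_n - c Q_n). *)
Lemma mgf_le t (th := `|t| * e / (1 - `|t| * e)) : `|t| * e < 1 ->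
  (\int[P]_w (expR (t * martingale_sum n xi w))%:E <=
   (expR (t ^+ 2 / 2 * (1 + th) * (1 + dl ^+ 2)))%:E)%E.
Proof.
move=> te; set c := t ^+ 2 / 2 * (1 + th).
have c0 : 0 <= c.
  rewrite mulr_ge0// ?divr_ge0 ?sqr_ge0// addr_ge0//.
  by apply: divr_ge0; [apply: mulr_ge0 => //; exact: ltW|rewrite subr_ge0 ltW].
have mE : measurable_fun setT (fun w => expR (t * S n w - c * Q n w)).
  apply: measurableT_comp => //; apply: measurable_funB; apply: measurable_funM => //.
    exact: measurable_martingale_sum.
  exact: measurable_quadratic_char.
apply: (@le_trans _ _ (\int[P]_w ((expR (c * (1 + dl ^+ 2)))%:E *
    (expR (t * S n w - c * Q n w))%:E))%E).
  apply: ae_ge0_le_integral => //.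
  - apply/measurable_EFinP/measurableT_comp => //; apply: measurable_funM => //.
    exact: measurable_martingale_sum.
  - by apply/measurable_EFinP; exact: measurable_funM.
  - apply: filterS A2 => w; rewrite ler_norml => /andP[_ Qle] _.
    rewrite -EFinM -expRD lee_fin ler_expR addrCA lerDl -mulrBr mulr_ge0//.
    by rewrite /Q; lra.
rewrite ge0_integralZl//; last first.
  exact/measurable_EFinP.
rewrite -[leRHS]mule1 lee_wpmul2l ?lee_fin ?expR_ge0//.
apply: integral_expR_supermartingale => i A ni FA.
apply: (integral_expR_le (md_sigma md (ltnW ni)) (md_sub md (ltnW ni))) => //.
- exact: measurable_difference.
- exact: (md_sqint md).
- exact: (md_center md (i := i.+1)).
- by move=> k k3; exact: (A1 (i := i.+1)).
Qed.

(** As c >= 0 and Q_n >= 1 - dl^2, exp (t S_n) is at least exp (c (1 - dl^2)) times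
    the submartingale exp (t S_n - c Q_n). *)
Lemma mgf_ge t (th := `|t| * e / (1 - `|t| * e)) (s := 6 * t ^+ 2 * e ^+ 2) :
  `|t| * e < 1 -> th <= 1 -> s <= 1 ->
  ((expR (t ^+ 2 / 2 * (1 - th) * (1 - s) * (1 - dl ^+ 2)))%:E <=
   \int[P]_w (expR (t * martingale_sum n xi w))%:E)%E.
Proof.
move=> te th1 s1; set c := t ^+ 2 / 2 * (1 - th) * (1 - s).
have c0 : 0 <= c.
  apply: mulr_ge0; last by rewrite subr_ge0.
  by apply: mulr_ge0; [rewrite divr_ge0 ?sqr_ge0|rewrite subr_ge0].
have mS : measurable_fun setT (fun w => expR (t * S n w)).
  by apply: measurableT_comp => //; apply: measurable_funM => //; exact: measurable_martingale_sum.
have mE : measurable_fun setT (fun w => expR (t * S n w - c * Q n w)).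
  apply: measurableT_comp => //; apply: measurable_funB; apply: measurable_funM => //.
    exact: measurable_martingale_sum.
  exact: measurable_quadratic_char.
have : (1 <= \int[P]_w (expR (t * S n w - c * Q n w))%:E)%E.
  apply: integral_expR_submartingale => i A ni FA.
  apply: (integral_expR_ge (md_sigma md (ltnW ni)) (md_sub md (ltnW ni))) => //.
  - exact: measurable_difference.
  - exact: (md_sqint md).
  - exact: (md_center md (i := i.+1)).
  - by move=> k k3; exact: (A1 (i := i.+1)).
move=> le1.
have : (1 <= (expR (- (c * (1 - dl ^+ 2))))%:E *
    \int[P]_w (expR (t * S n w))%:E)%E.
  apply: (le_trans le1).
  rewrite -ge0_integralZl//; last first.
    exact/measurable_EFinP.
  apply: ae_ge0_le_integral => //.
  - exact/measurable_EFinP.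
  - by apply/measurable_EFinP; exact: measurable_funM.
  - apply: filterS A2 => w; rewrite ler_norml => /andP[Qge _] _.
    rewrite -EFinM -expRD lee_fin ler_expR addrC lerD2r lerN2 ler_wpM2l//.
    by rewrite /Q; lra.
move=> le2; rewrite -[leLHS]mule1.
have E0 : (0 <= (expR (c * (1 - dl ^+ 2)))%:E)%E by rewrite lee_fin expR_ge0.
apply: le_trans (lee_wpmul2l E0 le2) _.
by rewrite muleA -EFinM -expRD subrr expR0 mul1e.
Qed.

End martingale_mgf.

(** * Large deviations from the scaled cumulant generating function *)

Lemma limn_esup_near_le (R : realType) (u : (\bar R)^nat) (l : \bar R) :
  (\forall n \near \oo, (u n <= l)%E) -> (limn_esup u <= l)%E.
Proof.
move=> ul; apply: (@le_trans _ _ (ereal_sup [set u n | n in [set n | (u n <= l)%E]])).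
  by apply: ereal_inf_lbound; exists [set n | (u n <= l)%E].
by apply: ge_ereal_sup => _ [n /= un <-].
Qed.

(** Constant factors are negligible at the exponential scale a_n^2. *)
Lemma near_le_expR_sqr (R : realType) (a : R^nat) (C k : R) :
  a n @[n --> \oo] --> +oo -> 0 < k ->
  \forall n \near \oo, C <= expR (a n ^+ 2 * k).
Proof.
move=> ha k0; near=> n.
have a1 : 1 <= a n by near: n; move/cvgryPge : ha; exact.
have aC : C / k <= a n by near: n; move/cvgryPge : ha; exact.
apply: le_trans (expR_ge1Dx _).
have : C / k <= a n ^+ 2 by apply: le_trans aC _; rewrite expr2; nra.
by rewrite ler_pdivrMr// => /le_trans; apply; rewrite lerDr.
Unshelve. all: by end_near. Qed.

Section scaled_log_prob_bounds.
Context (R : realType) (d : measure_display) (T : measurableType d)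
  (P : probability T R) (X : T -> R) (a : R) (B : set R).
Hypothesis a0 : 0 < a.

Lemma scaled_log_prob_le c :
  (P [set w | B (a^-1 * X w)%R] <= (expR (a ^+ 2 * c))%:E)%E ->
  (scaled_log_prob P X a B <= c%:E)%E.
Proof.
move=> h; have a2 : 0 < a ^+ 2 by rewrite exprn_gt0.
have -> : c%:E = ((a ^+ 2)^-1%:E * (a ^+ 2 * c)%:E)%E.
  by rewrite -EFinM mulKf// gt_eqF.
apply: lee_wpmul2l; first by rewrite lee_fin invr_ge0 ltW.
rewrite -[leRHS]expeRK.
by rewrite lee_lne// in_itv/= leey andbT// lee_fin expR_ge0.
Qed.

Lemma scaled_log_prob_ge c :
  ((expR (a ^+ 2 * c))%:E <= P [set w | B (a^-1 * X w)%R])%E ->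
  (c%:E <= scaled_log_prob P X a B)%E.
Proof.
move=> h; have a2 : 0 < a ^+ 2 by rewrite exprn_gt0.
have -> : c%:E = ((a ^+ 2)^-1%:E * (a ^+ 2 * c)%:E)%E.
  by rewrite -EFinM mulKf// gt_eqF.
apply: lee_wpmul2l; first by rewrite lee_fin invr_ge0 ltW.
rewrite -[leLHS]expeRK.
by rewrite lee_lne// in_itv/= leey andbT// lee_fin expR_ge0.
Qed.

Hypothesis mX : measurable_fun setT X.
Hypothesis mB : measurable B.
Let M t : \bar R := (\int[P]_w (expR (t * a * X w))%:E)%E.

Lemma measurable_scaled_event : measurable [set w | B (a^-1 * X w)].
Proof.
rewrite -[X in measurable X]setTI.
by apply: (measurable_funM (measurable_cst a^-1) mX).
Qed.

Lemma measurable_expR_scaled t : measurable_fun setT (fun w => expR (t * a * X w)).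
Proof. by apply: measurableT_comp => //; exact: measurable_funM. Qed.

Let ge0_integralZl_fun (k : R) (f : T -> R) : 0 <= k -> measurable_fun setT f ->
  (forall w, 0 <= f w) ->
  (k%:E * \int[P]_w (f w)%:E = \int[P]_w (k * f w)%:E)%E.
Proof.
move=> k0 mf f0; rewrite -ge0_integralZl//; first exact/measurable_EFinP.
by move=> w _; rewrite lee_fin.
Qed.

Let ge0_integralD_fun (f g : T -> R) :
  measurable_fun setT f -> measurable_fun setT g ->
  (forall w, 0 <= f w) -> (forall w, 0 <= g w) ->
  (\int[P]_w (f w)%:E + \int[P]_w (g w)%:E = \int[P]_w (f w + g w)%:E)%E.
Proof.
move=> mf mg f0 g0; rewrite -ge0_integralD//; try exact/measurable_EFinP.
- by move=> w _; rewrite lee_fin.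
- by move=> w _; rewrite lee_fin.
Qed.

Let indic_event (w : T) : R := \1_[set w | B (a^-1 * X w)] w.

Let measurable_indic_event : measurable_fun setT indic_event.
Proof. exact/measurable_indic/measurable_scaled_event. Qed.

Let integral_indic_event :
  (P [set w | B (a^-1 * X w)%R] = \int[P]_w (indic_event w)%:E)%E.
Proof. by rewrite integral_indic ?setIT//; exact: measurable_scaled_event. Qed.

(** Chernoff bound on both sides: the indicator of B (X/a) is at most
    exp (r a X - a^2 r^2) + exp (- r a X - a^2 r^2). *)
Lemma prob_scaled_le r : 0 <= r -> (forall x, B x -> r <= `|x|) ->
  (P [set w | B (a^-1 * X w)%R] <=
   (expR (- (a ^+ 2 * r ^+ 2)))%:E * (M r + M (- r)))%E.
Proof.
move=> r0 Br; have mE := measurable_expR_scaled.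
have E0 t w : 0 <= expR (t * a * X w) by exact: expR_ge0.
rewrite integral_indic_event ge0_integralD_fun// ge0_integralZl_fun;
  [|exact: expR_ge0|exact: measurable_funD|by move=> w; rewrite addr_ge0].
apply: ge0_le_integral => //.
- by move=> w _; rewrite lee_fin.
- exact/measurable_EFinP.
- by apply/measurable_EFinP; apply: measurable_funM => //; exact: measurable_funD.
move=> w _; rewrite lee_fin mulrDr -!expRD /indic_event indicE.
case: (boolP (w \in _)) => [/set_mem/= /Br|_]; last by rewrite addr_ge0 ?expR_ge0.
set y := a^-1 * X w; have -> : X w = a * y by rewrite /y mulVKf// gt_eqF.
have a2r : 0 <= a ^+ 2 * r by apply: mulr_ge0 => //; exact: sqr_ge0.
rewrite ler_normr => /orP[] ry.
  rewrite -[leLHS]addr0 lerD ?expR_ge0// -[leLHS]expR0 ler_expR.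
  rewrite (_ : _ + _ = a ^+ 2 * r * (y - r)); last by ring.
  by rewrite mulr_ge0 ?subr_ge0.
rewrite -[leLHS]add0r lerD ?expR_ge0// -[leLHS]expR0 ler_expR.
rewrite (_ : _ + _ = a ^+ 2 * r * (- y - r)); last by ring.
by rewrite mulr_ge0 ?subr_ge0.
Qed.

(** Pointwise, with y = X/a: if |y - x| < r then x a X = a^2 x y is at most
    a^2 (x^2 + |x| r); if y >= x + r then multiplying exp (x a X) by
    exp (a^2 r (y - x - r)) >= 1 gives the second term; symmetrically if y <= x - r. *)
Lemma mgf_le_prob_ball x r : 0 < r -> (forall y, `|y - x| < r -> B y) ->
  (M x <= (expR (a ^+ 2 * (x ^+ 2 + `|x| * r)))%:E *
            P [set w | B (a^-1 * X w)%R]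
        + (expR (- (a ^+ 2 * (r * (x + r)))))%:E * M (x + r)
        + (expR (a ^+ 2 * (r * (x - r))))%:E * M (x - r))%E.
Proof.
move=> r0 Bx; have mE := measurable_expR_scaled.
have E0 t w : 0 <= expR (t * a * X w) by exact: expR_ge0.
rewrite integral_indic_event !ge0_integralZl_fun ?expR_ge0//.
have mK (k : R) (f : T -> R) : measurable_fun setT f -> measurable_fun setT (fun w => k * f w).
  by move=> mf; exact: measurable_funM.
have K0 (k : R) (f : T -> R) : (forall w, 0 <= f w) -> forall w, 0 <= expR k * f w.
  by move=> f0 w; rewrite mulr_ge0 ?expR_ge0.
have I0 w : 0 <= indic_event w by rewrite /indic_event indicE.
rewrite ge0_integralD_fun; [|exact: mK|exact: mK|exact: K0|exact: K0].
rewrite ge0_integralD_fun;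
  [|by apply: measurable_funD; exact: mK|exact: mK| |exact: K0]; last first.
  by move=> w; rewrite addr_ge0// K0.
apply: ge0_le_integral => //.
- exact/measurable_EFinP.
- by apply/measurable_EFinP; apply: measurable_funD; [apply: measurable_funD|]; exact: mK.
move=> w _; rewrite lee_fin -!expRD /indic_event indicE.
set y := a^-1 * X w; have -> : X w = a * y by rewrite /y mulVKf// gt_eqF.
have a2 : 0 <= a ^+ 2 by exact: sqr_ge0.
have a2r : 0 <= a ^+ 2 * r by apply: mulr_ge0 => //; exact: ltW.
have [yB|yB] := ltP `|y - x| r.
  rewrite mem_set/=; last exact: Bx.
  rewrite mulr1 -addrA ler_wpDr ?addr_ge0 ?expR_ge0// ler_expR.
  rewrite (_ : x * a * (a * y) = a ^+ 2 * (x ^+ 2 + x * (y - x))); last by ring.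
  rewrite ler_wpM2l// lerD2l; apply: le_trans (ler_norm _) _.
  by rewrite normrM ler_wpM2l// ltW.
move: yB; rewrite ler_normr => /orP[] yr.
  rewrite addrAC ler_wpDl ?addr_ge0 ?mulr_ge0 ?expR_ge0// ler_expR.
  rewrite -subr_ge0 (_ : _ - _ = a ^+ 2 * r * (y - x - r)); last by ring.
  by rewrite mulr_ge0 ?subr_ge0.
rewrite ler_wpDl ?addr_ge0 ?mulr_ge0 ?expR_ge0// ler_expR.
rewrite -subr_ge0 (_ : _ - _ = a ^+ 2 * r * (- (y - x) - r)); last by ring.
by rewrite mulr_ge0 ?subr_ge0.
Qed.

End scaled_log_prob_bounds.

Section ldp_of_scaled_cgf.
Context (R : realType) (d : nat -> measure_display)
  (T : forall n : nat, measurableType (d n))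
  (P : forall n : nat, probability (T n) R) (X : forall n : nat, T n -> R)
  (a : R^nat).
Hypothesis ha : a n @[n --> \oo] --> +oo.
Hypothesis mX : \forall n \near \oo, measurable_fun setT (@X n).
Hypothesis cgf : forall t eta : R, 0 < eta -> \forall n \near \oo,
  ((expR (a n ^+ 2 * (t ^+ 2 / 2 - eta)))%:E <=
     \int[P n]_w (expR (t * a n * @X n w))%:E <=
   (expR (a n ^+ 2 * (t ^+ 2 / 2 + eta)))%:E)%E.
Variable B : set R.
Hypothesis mB : measurable B.

Let near_a_gt0 : \forall n \near \oo, 0 < a n.
Proof. by move/cvgryPgt : ha; exact. Qed.

Lemma limn_esup_scaled_log_prob_le s : 0 <= s -> (forall x, B x -> s <= x ^+ 2 / 2) ->
  (limn_esup (fun n => scaled_log_prob (P n) (@X n) (a n) B) <= (- s)%:E)%E.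
Proof.
move=> s0 Bs; apply/lee_addgt0Pr => eta eta0; rewrite -EFinD.
pose r := Num.sqrt (2 * s); have r2 : r ^+ 2 = 2 * s by rewrite sqr_sqrtr ?mulr_ge0.
have Br x : B x -> r <= `|x|.
  move=> /Bs sx; rewrite -(@ler_pXn2r _ 2)// ?nnegrE ?sqrtr_ge0//.
  by rewrite r2 real_normK ?num_real// -ler_pdivlMl// mulrC.
have eta2 : 0 < eta / 2 by rewrite divr_gt0.
apply: limn_esup_near_le; near=> n.
have an : 0 < a n by near: n.
apply: scaled_log_prob_le => //.
apply: (le_trans (prob_scaled_le _ _ _ _ _ Br)) => //; rewrite ?sqrtr_ge0//.
  by near: n.
have /andP[_ M1] : ((expR (a n ^+ 2 * (r ^+ 2 / 2 - eta / 2)))%:E <=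
     \int[P n]_w (expR (r * a n * @X n w))%:E <=
   (expR (a n ^+ 2 * (r ^+ 2 / 2 + eta / 2)))%:E)%E by near: n; exact: cgf.
have /andP[_ M2] : ((expR (a n ^+ 2 * ((- r) ^+ 2 / 2 - eta / 2)))%:E <=
     \int[P n]_w (expR (- r * a n * @X n w))%:E <=
   (expR (a n ^+ 2 * ((- r) ^+ 2 / 2 + eta / 2)))%:E)%E by near: n; exact: cgf.
rewrite sqrrN in M2.
have E2 : 2 <= expR (a n ^+ 2 * (eta / 2)) by near: n; exact: near_le_expR_sqr.
apply: (le_trans (lee_wpmul2l _ (leeD M1 M2))); first by rewrite lee_fin expR_ge0.
rewrite -EFinD -EFinM lee_fin mulrDr -expRD -mulr2n -[leLHS]mulr_natl.
apply: (le_trans (ler_wpM2r (expR_ge0 _) E2)).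
rewrite -expRD ler_expR r2; nra.
Unshelve. all: by end_near. Qed.

(** In [mgf_le_prob_ball], the two Chernoff terms have exponent
    x^2/2 - r^2/2 + k against x^2/2 - k on the left: as k <= r^2/8, they are
    eventually at most half of the left side, so the ball carries the other half. The
    losses |x| r and 2k in the exponent are kept below eta/2 each. *)
Lemma limn_einf_scaled_log_prob_ge x : interior B x ->
  ((- (x ^+ 2 / 2))%:E <=
    limn_einf (fun n => scaled_log_prob (P n) (@X n) (a n) B))%E.
Proof.
move=> /nbhs_ballP[r0 /= r00 Br0].
(* [leeNr] sees limn_einf u as - limn_esup (- u), its definition. *)
rewrite leeNr; apply/lee_addgt0Pr => eta eta0; rewrite -EFinN opprK -EFinD.
pose r := Num.min r0 (eta / (2 * (`|x| + 1))).
have x1 : 0 < `|x| + 1 by rewrite ltr_wpDl.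
have r_gt0 : 0 < r by rewrite lt_min r00 divr_gt0// mulr_gt0.
have xr : `|x| * r <= eta / 2.
  apply: (@le_trans _ _ ((`|x| + 1) * (eta / (2 * (`|x| + 1))))).
    by apply: ler_pM => //; rewrite ?lerDl ?ge_min ?lexx ?orbT// ltW.
  by rewrite le_eqVlt; apply/orP; left; apply/eqP; field; exact: lt0r_neq0.
have Br y : `|y - x| < r -> B y.
  by rewrite lt_min => /andP[yr _]; apply: Br0; rewrite /ball/= distrC.
pose k := Num.min (eta / 4) (r ^+ 2 / 8).
have k0 : 0 < k by rewrite lt_min !divr_gt0// exprn_gt0.
have k_eta : k <= eta / 4 by rewrite ge_min lexx.
have k_r : k <= r ^+ 2 / 8 by rewrite ge_min lexx orbT.
apply: limn_esup_near_le; near=> n.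
have an : 0 < a n by near: n.
rewrite leeNl -EFinN; apply: scaled_log_prob_ge => //.
have mXn : measurable_fun setT (@X n) by near: n.
have := mgf_le_prob_ball (P n) an mXn mB r_gt0 Br.
have /andP[M0 _] : ((expR (a n ^+ 2 * (x ^+ 2 / 2 - k)))%:E <=
     \int[P n]_w (expR (x * a n * @X n w))%:E <=
   (expR (a n ^+ 2 * (x ^+ 2 / 2 + k)))%:E)%E by near: n; exact: cgf.
have /andP[_ M1] : ((expR (a n ^+ 2 * ((x + r) ^+ 2 / 2 - k)))%:E <=
     \int[P n]_w (expR ((x + r) * a n * @X n w))%:E <=
   (expR (a n ^+ 2 * ((x + r) ^+ 2 / 2 + k)))%:E)%E by near: n; exact: cgf.
have /andP[_ M2] : ((expR (a n ^+ 2 * ((x - r) ^+ 2 / 2 - k)))%:E <=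
     \int[P n]_w (expR ((x - r) * a n * @X n w))%:E <=
   (expR (a n ^+ 2 * ((x - r) ^+ 2 / 2 + k)))%:E)%E by near: n; exact: cgf.
have E2 : 2 <= expR (a n ^+ 2 * k) by near: n; exact: near_le_expR_sqr.
have E4 : 4 <= expR (a n ^+ 2 * (r ^+ 2 / 4)).
  by near: n; apply: near_le_expR_sqr => //; rewrite divr_gt0// exprn_gt0.
have a2 : 0 <= a n ^+ 2 by exact: sqr_ge0.
move/(le_trans M0).
rewrite -(@fineK _ (P n _)); last first.
  by apply: fin_num_measure; exact: measurable_scaled_event.
set p := fine _; rewrite lee_fin => main.
have {main} : ((expR (a n ^+ 2 * (x ^+ 2 / 2 - k)))%:E <=
    (expR (a n ^+ 2 * (x ^+ 2 + `|x| * r)) * p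
     + expR (a n ^+ 2 * (x ^+ 2 / 2 - r ^+ 2 / 2 + k)) *+ 2)%:E)%E.
  (* Both Chernoff exponents, divided by a_n^2, equal x^2/2 - r^2/2 + k. *)
  apply: (le_trans main); rewrite -EFinM mulr2n addrA !EFinD.
  apply: leeD; first apply: leeD => //.
    apply: (le_trans (lee_wpmul2l _ M1)); first by rewrite lee_fin expR_ge0.
    rewrite -EFinM -expRD lee_fin ler_expR le_eqVlt; apply/orP; left; apply/eqP.
    by field.
  apply: (le_trans (lee_wpmul2l _ M2)); first by rewrite lee_fin expR_ge0.
  rewrite -EFinM -expRD lee_fin ler_expR le_eqVlt; apply/orP; left; apply/eqP.
  by field.
rewrite lee_fin; set E0 := expR (_ * (_ - k)); set K := expR (_ * (_ + _ * r)).
set G := expR _ => main.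
have G4 : 4 * G <= E0.
  apply: (le_trans (ler_wpM2r (expR_ge0 _) E4)).
  by rewrite -expRD ler_expR -mulrDr ler_wpM2l//; lra.
have zK : expR (a n ^+ 2 * - (x ^+ 2 / 2 + eta)) * K * 2 <= E0.
  apply: (le_trans (ler_wpM2l _ E2)); first by rewrite mulr_ge0// expR_ge0.
  by rewrite -!expRD ler_expR -!mulrDr ler_wpM2l//; lra.
have K0 : 0 < K by exact: expR_gt0.
rewrite -(ler_pM2l K0); rewrite mulr2n in main; lra.
Unshelve. all: by end_near. Qed.

Theorem ldp_of_scaled_cgf (v := fun n => scaled_log_prob (P n) (@X n) (a n) B) :
  [/\ (- gauss_rate_inf (interior B) <= limn_einf v)%E,
      (limn_einf v <= limn_esup v)%E &
      (limn_esup v <= - gauss_rate_inf (closure B))%E].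
Proof.
split; last 2 first.
- exact: limn_einf_sup.
- have [[x Bx]|B0] := pselect (exists x, B x); last first.
    (* If B is empty then every s >= 0 is a lower bound for the rate on B. *)
    have -> : (limn_esup v = -oo)%E.
      rewrite -[LHS]oppeK (_ : (- limn_esup v)%E = +oo%E)//; apply/eqyP => s s0.
      rewrite leeNr -EFinN; apply: limn_esup_scaled_log_prob_le; first exact: ltW.
      by move=> x Bx; case: B0; exists x.
    by rewrite leNye.
  have Iub y : B y -> (gauss_rate_inf (closure B) <= (y ^+ 2 / 2)%:E)%E.
    by move=> By; apply: ereal_inf_lbound; exists y => //; exact: subset_closure.
  have I0 : (0 <= gauss_rate_inf (closure B))%E.
    by apply: le_ereal_inf_tmp => _ [y _ <-]; rewrite lee_fin divr_ge0// sqr_ge0.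
  move: (gauss_rate_inf _) I0 Iub => [s| |//] I0 Iub; last by have := Iub x Bx.
  by apply: limn_esup_scaled_log_prob_le => // y /Iub.
rewrite leeNl; apply: le_ereal_inf_tmp => _ [x Bx <-].
by rewrite leeNl -EFinN; exact: limn_einf_scaled_log_prob_ge.
Qed.

End ldp_of_scaled_cgf.

(** * The moderate deviation principle *)

(** The conditions and exponents of [mgf_le] and [mgf_ge] at t a_n, divided by
    a_n^2: they only depend on n through a_n eps_n and delta_n. *)
Lemma near_scaled_cgf_exponents (R : realType) (eps delta a : R^nat) (t eta : R) :
  eps n @[n --> \oo] --> (0 : R) -> delta n @[n --> \oo] --> (0 : R) ->
  a n * eps n @[n --> \oo] --> (0 : R) ->
  (forall n, (1 <= n)%N -> 0 < eps n) -> 0 < eta ->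
  \forall n \near \oo,
    let u := `|t * a n| * eps n in let th := u / (1 - u) in
    let s := 6 * (t * a n) ^+ 2 * eps n ^+ 2 in
    [/\ u < 1, th <= 1, s <= 1,
      t ^+ 2 / 2 * (1 + th) * (1 + delta n ^+ 2) <= t ^+ 2 / 2 + eta &
      t ^+ 2 / 2 - eta <= t ^+ 2 / 2 * (1 - th) * (1 - s) * (1 - delta n ^+ 2)].
Proof.
move=> heps hdelta haeps eps0 eta0.
pose w n := `|t * (a n * eps n)|; pose th n := w n / (1 - w n).
have cst_cvg (c : R) : c @[_ --> \oo] --> c by exact: cvg_cst.
have cw : w n @[n --> \oo] --> (0 : R).
  have := cvg_norm (cvgM (cst_cvg t) haeps); rewrite mulr0 normr0; exact.
have cth : th n @[n --> \oo] --> (0 : R).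
  have d0 : 1 - 0 != 0 :> R by rewrite subr0 oner_eq0.
  by have := cvgM cw (cvgV d0 (cvgB (cst_cvg 1) cw)); rewrite mul0r; exact.
have cs : 6 * w n ^+ 2 @[n --> \oo] --> (0 : R).
  by have := cvgM (cst_cvg 6) (cvgM cw cw); rewrite !mulr0; exact.
have cd : delta n ^+ 2 @[n --> \oo] --> (0 : R).
  by have := cvgM hdelta hdelta; rewrite mulr0; exact.
have cup : t ^+ 2 / 2 * (1 + th n) * (1 + delta n ^+ 2) @[n --> \oo] --> t ^+ 2 / 2.
  have := cvgM (cvgM (cst_cvg (t ^+ 2 / 2)) (cvgD (cst_cvg 1) cth))
    (cvgD (cst_cvg 1) cd).
  by rewrite addr0 !mulr1; exact.
have clo : t ^+ 2 / 2 * (1 - th n) * (1 - 6 * w n ^+ 2) * (1 - delta n ^+ 2)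
    @[n --> \oo] --> t ^+ 2 / 2.
  have := cvgM (cvgM (cvgM (cst_cvg (t ^+ 2 / 2)) (cvgB (cst_cvg 1) cth))
    (cvgB (cst_cvg 1) cs)) (cvgB (cst_cvg 1) cd).
  by rewrite subr0 !mulr1; exact.
near=> n.
have n1 : (1 <= n)%N by near: n; exact: nbhs_infty_ge.
have -> : `|t * a n| * eps n = w n.
  by rewrite /w mulrA [RHS]normrM (ger0_norm (ltW (eps0 n n1))).
rewrite (_ : 6 * (t * a n) ^+ 2 * eps n ^+ 2 = 6 * w n ^+ 2); last first.
  by rewrite /w real_normK ?num_real//; ring.
rewrite -/(th n); split.
- by near: n; apply: cvgr_lt cw _ _.
- by near: n; apply: cvgr_le cth _ _.
- by near: n; apply: cvgr_le cs _ _.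
- by near: n; apply: cvgr_le cup _ _; rewrite ltrDl.
- by near: n; apply: cvgr_ge clo _ _; rewrite gtrBl.
Unshelve. all: by end_near. Qed.

Theorem mainTheorem7 (R : realType)
    (d : nat -> measure_display) (T : forall n : nat, measurableType (d n))
    (P : forall n : nat, probability (T n) R)
    (F : forall n : nat, nat -> set (set (T n)))
    (xi : forall n : nat, nat -> T n -> R)
    (eps delta a : nat -> R)
    (hmd : forall n : nat, (1 <= n)%N ->
      martingale_differences (P n) n (F n) (xi n))
    (heps : forall n : nat, (1 <= n)%N -> 0 < eps n <= 2^-1)
    (hdelta : forall n : nat, (1 <= n)%N -> 0 <= delta n <= 2^-1)
    (hA1 : forall n : nat, (1 <= n)%N ->
      conditional_bernstein (P n) n (F n) (xi n) (eps n))
    (hA2 : forall n : nat, (1 <= n)%N ->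
      quadratic_char_near1 (P n) n (F n) (xi n) (delta n))
    (heps0 : eps n @[n --> \oo] --> (0 : R))
    (hdelta0 : delta n @[n --> \oo] --> (0 : R))
    (ha : a n @[n --> \oo] --> +oo)
    (haeps : a n * eps n @[n --> \oo] --> (0 : R))
    (B : set R) (hB : measurable B) :
  let v := fun n : nat =>
    scaled_log_prob (P n) (martingale_sum n (xi n)) (a n) B in
  [/\ (- gauss_rate_inf (interior B) <= limn_einf v)%E,
      (limn_einf v <= limn_esup v)%E &
      (limn_esup v <= - gauss_rate_inf (closure B))%E].
Proof.
move=> v; apply: (@ldp_of_scaled_cgf R d T P (fun n => martingale_sum n (xi n)) a ha) => //.
  near=> n; have n1 : (1 <= n)%N by near: n; exact: nbhs_infty_ge.
  exact: (measurable_martingale_sum (hmd n n1)).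
move=> t eta eta0.
have eps_gt0 n : (1 <= n)%N -> 0 < eps n by move=> /heps /andP[].
have exps := near_scaled_cgf_exponents t heps0 hdelta0 haeps eps_gt0 eta0.
near=> n; have n1 : (1 <= n)%N by near: n; exact: nbhs_infty_ge.
have [] := near exps n; first by [].
move=> u1 th1 s1 up lo.
have a2 : 0 <= a n ^+ 2 by exact: sqr_ge0.
apply/andP; split.
  apply: le_trans (mgf_ge (hmd n n1) (eps_gt0 n n1) (hA1 n n1) (hA2 n n1) u1 th1 s1).
  rewrite lee_fin ler_expR; apply: (le_trans (ler_wpM2l a2 lo)).
  by rewrite le_eqVlt; apply/orP; left; apply/eqP; ring.
apply: le_trans (mgf_le (hmd n n1) (eps_gt0 n n1) (hA1 n n1) (hA2 n n1) u1) _.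
rewrite lee_fin ler_expR; apply: le_trans (ler_wpM2l a2 up).
by rewrite le_eqVlt; apply/orP; left; apply/eqP; ring.
Unshelve. all: by end_near. Qed.
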